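(* Let $r\ge 2$. In $\mathrm{ITM}(r)$, the set of stable maps forms a full measure subset of the set of all finite type maps; that is, the set of finite type maps in $\mathrm{ITM}(r)$ that are not stable has Lebesgue measure zero.
   Context: Let $I=[0,1)$ and $r\ge 2$. The parameter space $\mathrm{ITM}(r)\subset\mathbb{R}^{2r-1}$ is the set of vectors $(\gamma_1,\dots,\gamma_r,\beta_1,\dots,\beta_{r-1})$ with $0=\beta_0<\beta_1<\dots<\beta_{r-1}<\beta_r=1$ and $\gamma_i\in[-\beta_{i-1},1-\beta_i]$ for $1\le i\le r$, with the metric, topology and Lebesgue measure induced from $\mathbb{R}^{2r-1}$. Each such vector is identified with the interval translation map $T\colon I\to I$, $T(x)=x+\gamma_i$ for $x\in[\beta_{i-1},\beta_i)$. The points $\beta_1,\dots,\beta_{r-1}$ are the discontinuities of $T$. For $T\in\mathrm{ITM}(r)$ put $X_n=T^n(I)$, $X(T)=\bigcap_{n\ge 0}X_n$, and let $\overline{X}(T)$ be the closure of $X(T)$ in $[0,1]$. $T$ is of finite type if $X_{n+1}=X_n$ for some $n$. $T\in\mathrm{ITM}(r)$ is called stable if there is a neighbourhood $\mathcal{U}$ of $T$ in $\mathrm{ITM}(r)$ such that: (1) the mapping $\tilde T\mapsto\overline{X}(\tilde T)$ is continuous on $\mathcal{U}$ with respect to the Hausdorff topology on compact subsets of $[0,1]$, and for each $\tilde T\in\mathcal{U}$ the set $\overline{X}(\tilde T)$ is homeomorphic to $\overline{X}(T)$; (2) the number of discontinuities of $\tilde T$ lying in $I\setminus\overline{X}(\tilde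 T)$ is constant for $\tilde T\in\mathcal{U}$. *)

(* Defs.v *)
From HB Require Import structures.
From mathcomp Require Import all_boot all_order all_algebra.
From mathcomp Require Import all_classical all_reals all_analysis.
Import numFieldNormedType.Exports.

Set Implicit Arguments.
Unset Strict Implicit.
Unset Printing Implicit Defensive.
Import Order.TTheory GRing.Theory Num.Theory.
Local Open Scope classical_set_scope.
Local Open Scope ring_scope.

(* A parameter (gamma_1, .., gamma_r, beta_1, .., beta_(r-1)) is a row vector
   of length r + (r - 1); the index i : 'I_r stands for gamma_(i+1). *)
Definition gam (R : realType) (r : nat) (p : 'rV[R]_(r + r.-1)) (i : 'I_r) : R :=
  p ord0 (lshift r.-1 i).

(* The convention beta_0 = 0, beta_r = 1 is built in: for k = k'.+1 the value is
   coordinate k' of the beta-block when k' < r - 1, and 1 otherwise. *)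
Definition bet (R : realType) (r : nat) (p : 'rV[R]_(r + r.-1)) (k : nat) : R :=
  if k is k'.+1 then
    if insub k' is Some j then p ord0 (rshift r (j : 'I_r.-1)) else 1
  else 0.

Definition ITM (R : realType) (r : nat) : set 'rV[R]_(r + r.-1) :=
  [set p | forall i : 'I_r,
     [/\ bet p i < bet p i.+1, - bet p i <= gam p i & gam p i <= 1 - bet p i.+1]].

Definition unitI (R : realType) : set R := [set x | 0 <= x < 1].
Arguments unitI : clear implicits.

(* Only the restriction to [0, 1) matters; outside it the map is the identity. *)
Definition itm (R : realType) (r : nat) (p : 'rV[R]_(r + r.-1)) (x : R) : R :=
  if [pick i : 'I_r | bet p i <= x < bet p i.+1] is Some i
  then x + gam p i else x.

Definition Xn (R : realType) (r : nat) (p : 'rV[R]_(r + r.-1)) (n : nat) : set R :=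
  iter n (itm p) @` unitI R.

Definition attr (R : realType) (r : nat) (p : 'rV[R]_(r + r.-1)) : set R :=
  \bigcap_n Xn p n.

(* For p in ITM r this lies in [0, 1], so the closure in R is the closure in
   [0, 1]. *)
Definition cattr (R : realType) (r : nat) (p : 'rV[R]_(r + r.-1)) : set R :=
  closure (attr p).

Definition finite_type (R : realType) (r : nat) (p : 'rV[R]_(r + r.-1)) : Prop :=
  exists n, Xn p n.+1 = Xn p n.

Definition thicken (R : realType) (A : set R) (e : R) : set R :=
  \bigcup_(a in A) ball a e.

(* Extended-valued, so that the empty set is at distance +oo from every
   nonempty set. *)
Definition hausdorff_dist (R : realType) (A B : set R) : \bar R :=
  ereal_inf [set e%:E | e in
    [set e : R | [/\ 0 < e, A `<=` thicken B e & B `<=` thicken A e]]].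

Definition homeomorphic (R : realType) (A B : set R) : Prop :=
  exists f g : R -> R,
    [/\ {within A, continuous f}, {within B, continuous g},
        set_fun A B f, set_fun B A g
      & (forall x, A x -> g (f x) = x) /\ (forall y, B y -> f (g y) = y)].

Definition num_disc_outside (R : realType) (r : nat)
    (p : 'rV[R]_(r + r.-1)) : nat :=
  #|[pred j : 'I_r.-1 | `[< (unitI R `\` cattr p) (bet p j.+1) >]]|.

Definition hausdorff_continuous_on (R : realType) (r : nat)
    (U : set 'rV[R]_(r + r.-1)) (F : 'rV[R]_(r + r.-1) -> set R) : Prop :=
  forall p, U p -> forall e : R, 0 < e ->
    \forall q \near within U (nbhs p), (hausdorff_dist (F q) (F p) < e%:E)%E.

(* V `&` ITM r, for V a neighbourhood of p in R^(2r-1), is a neighbourhood of p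
   in the subspace ITM r. *)
Definition stable (R : realType) (r : nat) (p : 'rV[R]_(r + r.-1)) : Prop :=
  @ITM R r p /\
  exists2 V : set 'rV[R]_(r + r.-1), nbhs p V &
    let U := V `&` @ITM R r in
    [/\ hausdorff_continuous_on U (@cattr R r),
        (forall q, U q -> homeomorphic (cattr q) (cattr p))
      & (forall q, U q -> num_disc_outside q = num_disc_outside p)].

Definition box (R : realType) (n : nat) (a b : 'rV[R]_n) : set 'rV[R]_n :=
  [set x : 'rV[R]_n | forall i, a ord0 i <= x ord0 i <= b ord0 i].

(* n-dimensional Lebesgue outer measure: infimum of the total volume over
   countable covers by boxes [a_k, b_k]. A set is Lebesgue null iff this value
   is 0. *)
Definition lebesgue_outer (R : realType) (n : nat) (A : set 'rV[R]_n) : \bar R :=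
  ereal_inf [set s | exists a b : nat -> 'rV[R]_n,
    [/\ forall k i, a k ord0 i <= b k ord0 i,
        A `<=` \bigcup_k box (a k) (b k)
      & s = (\sum_(0 <= k <oo) (\prod_(i < n) (b k ord0 i - a k ord0 i))%:E)%E]].

(* Main.v *)
(** If the parameters of [p] satisfy no nontrivial integer affine relation, the
    finitely many integer affine forms that bound the components of the images
    [Xn q N] keep their order for all [q] near [p], and a coincidence of two of
    them at [p] is an identity. A piecewise linear homeomorphism of the line
    moving their values at [q] to those at [q'] then maps the attractor of [q]
    onto that of [q'], so a finite type [p] is stable. The exceptional
    parameters lie on countably many rational hyperplanes. *)

Require Import Defs.
From mathcomp Require Import all_boot all_order all_algebra.
From mathcomp Require Import all_classical all_reals all_analysis.
From mathcomp Require Import ring lra.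
Import numFieldNormedType.Exports.

Set Implicit Arguments.
Unset Strict Implicit.
Unset Printing Implicit Defensive.
Import Order.TTheory GRing.Theory Num.Theory.
Local Open Scope classical_set_scope.
Local Open Scope ring_scope.

(** * Increasing homeomorphisms of the line with prescribed values *)

Section IncreasingHomeomorphisms.
Variable R : realType.
Implicit Types (a b v w x y d : R) (h k : R -> R).

(** Continuity is not demanded: an order-preserving bijection of the line is automatically a
    homeomorphism. *)
Definition inc_homeo h k :=
  [/\ cancel h k, cancel k h & {mono h : x y / x <= y}].

Lemma inc_homeo_sym h k : inc_homeo h k -> inc_homeo k h.
Proof. by case=> hk kh hm; split=> // x y; rewrite -hm !kh. Qed.

Lemma inc_homeo_comp h k h' k' :
  inc_homeo h k -> inc_homeo h' k' -> inc_homeo (h' \o h) (k \o k').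
Proof.
move=> [hk kh hm] [hk' kh' hm']; split=> [x|x|x y] /=.
- by rewrite hk' hk.
- by rewrite kh kh'.
- by rewrite hm' hm.
Qed.

Lemma inc_homeo_continuous h k : inc_homeo h k -> continuous h.
Proof.
move=> [hk kh hm] x; apply/cvgrPdist_lt => e e0.
have hlt := leW_mono hm.
have kx1 : k (h x - e) < x by rewrite -hlt kh; lra.
have kx2 : x < k (h x + e) by rewrite -hlt kh; lra.
near=> y.
have ky1 : k (h x - e) < y by near: y; exact: lt_nbhsr.
have ky2 : y < k (h x + e) by near: y; exact: lt_nbhsl.
by rewrite ltr_distlC -[h x - e]kh -[h x + e]kh !hlt ky1 ky2.
Unshelve. all: by end_near. Qed.

Lemma homeo_preserves_closure h k (A B : set R) : inc_homeo h k ->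
  (forall x, A x <-> B (h x)) -> forall x, closure A x <-> closure B (h x).
Proof.
move=> hk AB x; have hc := inc_homeo_continuous hk.
have kc := inc_homeo_continuous (inc_homeo_sym hk).
case: hk => hk kh _; split=> [cA V hV|cB V hV].
  have [y [/AB ? ?]] := cA _ (hc x _ hV); by exists (h y).
have := kc (h x); rewrite /continuous_at hk => /(_ _ hV) kV.
have [y [By Vy]] := cB _ kV.
by exists (k y); split=> //; apply/AB; rewrite kh.
Qed.

(** The piecewise linear map that moves [w] to [v], with [[a, b]] as support and a single break at
    [w] inside it. *)
Definition bump a b w v x :=
  if x <= a then x else
  if x <= w then a + (x - a) * ((v - a) / (w - a)) else
  if x <= b then b - (b - x) * ((b - v) / (b - w)) else x.

(** On an affine piece, a point and its image are convex combinations with the same weights, of an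
    endpoint with [w] and with [v]; the displacement there is [s * (v - w)]. *)
Lemma bumpP a b w v x : a < w < b -> a < v < b ->
  [\/ x <= a /\ bump a b w v x = x,
      exists2 s, 0 <= s <= 1 & x = (1 - s) * a + s * w /\
        bump a b w v x = (1 - s) * a + s * v,
      exists2 s, 0 <= s <= 1 & x = (1 - s) * b + s * w /\
        bump a b w v x = (1 - s) * b + s * v |
      b <= x /\ bump a b w v x = x].
Proof.
move=> /andP[aw wb] /andP[av vb].
have wa : w - a != 0 by lra.
have bw : b - w != 0 by lra.
rewrite /bump; case: (leP x a) => xa; first by constructor 1.
case: (leP x w) => xw.
  constructor 2; exists ((x - a) / (w - a)); last by split; field.
  by rewrite divr_ge0 ?ler_pdivrMr /=; lra.
case: (leP x b) => xb.
  constructor 3; exists ((b - x) / (b - w)); last by split; field.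
  by rewrite divr_ge0 ?ler_pdivrMr /=; lra.
by constructor 4; split=> //; lra.
Qed.

Lemma bump_displacement a b w v x : a < w < b -> a < v < b ->
  `|bump a b w v x - x| <= `|v - w|.
Proof.
move=> wab vab.
have E s : 0 <= s <= 1 -> `|s * (v - w)| <= `|v - w|.
  move=> /andP[s0 s1]; rewrite normrM ger0_norm//.
  by rewrite ler_piMl.
case: (bumpP x wab vab) => [[_ ->]|[s s01 [-> ->]]|[s s01 [-> ->]]|[_ ->]].
- by rewrite subrr normr0.
- by rewrite [X in `|X|](_ : _ = s * (v - w)) ?E//; ring.
- by rewrite [X in `|X|](_ : _ = s * (v - w)) ?E//; ring.
- by rewrite subrr normr0.
Qed.

Lemma bump_fix a b w v x : a < w < b -> x <= a \/ b <= x ->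
  bump a b w v x = x.
Proof.
move=> /andP[aw wb]; rewrite /bump; case: (leP x a) => // xa [//|bx].
rewrite leNgt (lt_le_trans wb bx) /=.
by case: (leP x b) => // xb; rewrite (_ : b - x = 0) ?mul0r; lra.
Qed.

Lemma bump_peak a b w v : a < w < b -> bump a b w v w = v.
Proof.
move=> /andP[aw wb]; rewrite /bump leNgt aw /= lexx.
by field; lra.
Qed.

(** Exchanging [w] and [v] inverts the slopes; the bounds [p1] and [p2] place the image in the
    corresponding piece. *)
Lemma bumpK a b w v : a < w < b -> a < v < b ->
  cancel (bump a b w v) (bump a b v w).
Proof.
move=> /andP[aw wb] /andP[av vb] x; rewrite /bump.
have wa : w - a != 0 by lra.
have bw : b - w != 0 by lra.
have va : v - a != 0 by lra.
have bv : b - v != 0 by lra.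
case: (leP x a) => xa; first by rewrite xa.
case: (leP x w) => xw.
  have s0 : 0 < (v - a) / (w - a) by rewrite divr_gt0; lra.
  have p1 : 0 < (x - a) * ((v - a) / (w - a)) by rewrite mulr_gt0//; lra.
  have p2 : (x - a) * ((v - a) / (w - a)) <= v - a.
    by rewrite mulrA ler_pdivrMr ?subr_gt0// mulrC ler_pM2l; lra.
  rewrite ifN; last by rewrite -ltNge ltrDl.
  by rewrite ifT; [field; apply/andP|rewrite -lerBrDl].
case: (leP x b) => xb.
  have s0 : 0 < (b - v) / (b - w) by rewrite divr_gt0; lra.
  have p1 : 0 <= (b - x) * ((b - v) / (b - w)).
    by rewrite mulr_ge0 ?subr_ge0//; lra.
  have p2 : (b - x) * ((b - v) / (b - w)) < b - v.
    by rewrite mulrA ltr_pdivrMr ?subr_gt0// mulrC ltr_pM2l; lra.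
  rewrite ifN; last by rewrite -ltNge; clear s0; move: (_ * _) p1 p2 => z; lra.
  rewrite ifN; last by rewrite -ltNge; clear s0; move: (_ * _) p1 p2 => z; lra.
  by rewrite ifT; [field; apply/andP|rewrite gerBl].
by rewrite !ifN// -ltNge; lra.
Qed.

Lemma bump_homo a b w v : a < w < b -> a < v < b ->
  {homo bump a b w v : x y / x < y}.
Proof.
move=> /andP[aw wb] /andP[av vb] x y xy; rewrite /bump.
have s0 : 0 < (v - a) / (w - a) by rewrite divr_gt0; lra.
have t0 : 0 < (b - v) / (b - w) by rewrite divr_gt0; lra.
have sE : (w - a) * ((v - a) / (w - a)) = v - a by field; lra.
have tE : (b - w) * ((b - v) / (b - w)) = b - v by field; lra.
(* The slopes become abstract positive numbers, and multiplication by them a source of inequalities,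
   so that linear arithmetic suffices. *)
move: s0 t0 sE tE; move: (_ / _) (_ / _) => t s s0 t0 sE tE.
have S z z' : z < z' -> z * s < z' * s by rewrite ltr_pM2r.
have T z z' : z < z' -> z * t < z' * t by rewrite ltr_pM2r.
have S' z z' : z <= z' -> z * s <= z' * s by rewrite ler_pM2r.
have T' z z' : z <= z' -> z * t <= z' * t by rewrite ler_pM2r.
case: (leP x a) => xa.
  case: (leP y a) => ya; first by [].
  case: (leP y w) => yw.
    have : 0 < y - a by lra.
    by move=> /S; rewrite mul0r; lra.
  case: (leP y b) => yb; last by lra.
  have : b - y < b - w by lra.
    by move=> /T; lra.
rewrite [y <= a]leNgt (lt_trans xa xy) /=.
case: (leP x w) => xw.
  have : x - a <= w - a by lra.
  move=> /S' Hx.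
  case: (leP y w) => yw.
    have : x - a < y - a by lra.
    by move=> /S; lra.
  case: (leP y b) => yb; last by lra.
  have : b - y < b - w by lra.
    by move=> /T; lra.
rewrite [y <= w]leNgt (lt_trans xw xy) /=.
case: (leP x b) => xb; case: (leP y b) => yb; [| |lra|lra].
  have : b - y < b - x by lra.
    by move=> /T; lra.
have : 0 <= b - x by lra.
    by move=> /T'; rewrite mul0r; lra.
Qed.

Lemma bump_inc_homeo a b w v : a < w < b -> a < v < b ->
  inc_homeo (bump a b w v) (bump a b v w).
Proof.
by move=> w' v'; split; [exact: bumpK|exact: bumpK|exact/le_mono/bump_homo].
Qed.

(** No point of [s] separates [w] from [v]. An interval reaching 1 beyond both is shortened at each
    point of [s] in turn. *)
Lemma exists_gap (s : seq R) w v :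
  (forall c, c \in s -> (c < w) = (c < v) /\ c != w /\ c != v) ->
  exists a b, [/\ a < w < b, a < v < b & forall c, c \in s -> c <= a \/ b <= c].
Proof.
elim: s => [_|c s IH H].
  exists (Num.min w v - 1), (Num.max w v + 1).
  by split=> //; case: (leP w v) => ?; lra.
have [|a [b [wab vab gab]]] := IH.
  by move=> c' c's; apply: H; rewrite inE c's orbT.
have [Hc [cw cv]] := H c (mem_head _ _).
case: (ltP c w) Hc => [cw' /esym cv'|wc /esym/negbT].
  exists (Num.max a c), b; split.
  - by case: (leP a c) => ?; lra.
  - by case: (leP a c) => ?; lra.
  - move=> c'; rewrite inE => /orP[/eqP ->|/gab[]]; rewrite ?le_max ?lexx ?orbT.
    + by left.
    + by move=> ->; left.
    + by right.
rewrite -leNgt => vc.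
have {}wc : w < c by rewrite lt_neqAle eq_sym cw.
have {}vc : v < c by rewrite lt_neqAle eq_sym cv.
exists a, (Num.min b c); split.
- by case: (leP b c) => ?; lra.
- by case: (leP b c) => ?; lra.
- move=> c'; rewrite inE => /orP[/eqP ->|/gab[]]; rewrite ?ge_min ?lexx ?orbT.
  + by right.
  + by left.
  + by move=> ->; right.
Qed.

(* One point is moved at a time, by a bump supported in the gap left by the
   points already in place; the displacement at most doubles each time. *)
Lemma exists_inc_homeo (T : eqType) (s : seq T) (u v : T -> R) d : 0 <= d ->
  (forall i j, i \in s -> j \in s -> (u i <= u j) = (v i <= v j)) ->
  (forall i, i \in s -> `|u i - v i| <= d) ->
  exists h k, [/\ inc_homeo h k, forall i, i \in s -> h (u i) = v i &
    forall x, `|h x - x| <= (2 ^+ size s - 1) * d].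
Proof.
move=> d0; elim: s => [_ _|t s IH uv uvd].
  by exists id, id; split=> // x; rewrite subrr normr0 expr0 subrr mul0r.
have [| |h [k [hk hs hd]]] := IH.
- by move=> i j si sj; apply: uv; rewrite inE ?si ?sj orbT.
- by move=> i si; apply: uvd; rewrite inE si orbT.
have [_ _ hm] := hk; have hlt := leW_mono hm.
(* [u t] is within [d] of [v t], and [h] moves it by at most [(2 ^+ size s - 1) * d]. *)
have wv : `|v t - h (u t)| <= (2 ^+ size s) * d.
  have := hd (u t); have := uvd t (mem_head _ _); set e := 2 ^+ _.
  by rewrite !ler_norml => /andP[? ?] /andP[? ?]; apply/andP; split; nra.
have uvt i : i \in s -> (u i <= u t) = (v i <= v t) /\ (u t <= u i) = (v t <= v i).
  by move=> si; rewrite !uv// inE ?si ?eqxx ?orbT.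
have He : (2 ^+ size s - 1) * d <= (2 ^+ (size s).+1 - 1) * d.
  by rewrite ler_wpM2r// lerD2r exprS ler_peMl ?ler1n// exprn_ge0.
(* If [v t] is a value already attained, then [u t] equals the corresponding [u i], and [h] sends it
   to the right place as it is. *)
have [/hasP[i si /eqP vit]|/hasPn nv] := boolP (has (fun i => v i == v t) s).
  exists h, k; split=> //; last by move=> x; apply: le_trans He.
  move=> j; rewrite inE => /orP[/eqP->|/hs//].
  have [E1 E2] := uvt i si.
  have uit : u i = u t by apply/le_anti; rewrite E1 E2 vit lexx.
  by rewrite -uit hs.
have [|a [b [wab vab gab]]] := @exists_gap (map v s) (h (u t)) (v t).
  move=> _ /mapP[i si ->]; rewrite nv//.
  have [E1 E2] := uvt i si.
  rewrite -[in v i < h _]hs// -[in v i != h _]hs// hlt.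
  split; first by rewrite !ltNge E2.
  split=> //; apply: contra (nv _ si) => /eqP uit.
  by rewrite eq_le -E1 -E2 -(hm (u i)) -(hm (u t)) uit lexx.
exists (bump a b (h (u t)) (v t) \o h), (k \o bump a b (v t) (h (u t))); split.
- exact: inc_homeo_comp hk (bump_inc_homeo _ _).
- move=> i; rewrite inE => /orP[/eqP->|si] /=; first exact: bump_peak.
  by rewrite (hs i si) bump_fix//; exact/gab/map_f.
- move=> x /=; rewrite -[X in X - x](subrK (h x)) -addrA.
  apply: (le_trans (ler_normD _ _)).
  apply: (@le_trans _ _ (2 ^+ size s * d + (2 ^+ size s - 1) * d)).
    by rewrite lerD//; exact: le_trans (bump_displacement _ wab vab) wv.
  by rewrite exprS -mulrDl [X in X * d](_ : _ = 2 * 2 ^+ size s - 1)//; ring.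
Qed.

End IncreasingHomeomorphisms.

(** * Integer affine forms and the order of their values *)

Section IntegerForms.
Variables (R : realType) (n : nat).
Implicit Types (l : 'rV[int]_n * int) (p q : 'rV[R]_n).

(** Integer coefficients make the forms countable; as pairs of group elements they add
    componentwise. *)
Definition feval l q : R := \sum_j (l.1 ord0 j)%:~R * q ord0 j + l.2%:~R.

Lemma fevalD l l' q : feval (l + l') q = feval l q + feval l' q.
Proof.
rewrite /feval addrACA -big_split /= rmorphD; congr (_ + _).
by apply: eq_bigr => j _; rewrite mxE rmorphD mulrDl.
Qed.

Lemma feval_coord (j : 'I_n) q : feval (delta_mx ord0 j, 0) q = q ord0 j.
Proof.
rewrite /feval addr0 (bigD1 j)//= big1 => [|i ij].
  by rewrite mxE !eqxx mul1r addr0.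
by rewrite mxE (negbTE ij) andbF mul0r.
Qed.

Lemma feval_const (m : int) q : feval (0, m) q = m%:~R.
Proof. by rewrite /feval big1 ?add0r// => j _; rewrite mxE mul0r. Qed.

Lemma feval_continuous l : continuous (feval l : 'rV[R]_n -> R).
Proof.
have S (s : seq 'I_n) :
    continuous (fun q : 'rV[R]_n => \sum_(j <- s) (l.1 ord0 j)%:~R * q ord0 j).
  elim: s => [|j s IH].
    by under eq_fun do rewrite big_nil; exact: cst_continuous.
  under eq_fun do rewrite big_cons.
  move=> q; apply: continuousD (IH q); apply: continuousM; first exact: cst_continuous.
  exact: coord_continuous.
by move=> q; apply: continuousD (S _ _) _; exact: cst_continuous.
Qed.

(** Equivalently, 1 and the coordinates of [p] are linearly independent over the rationals. *)
Definition int_independent p := forall l, l.1 != 0 -> feval l p != 0.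

Definition same_order (L : seq ('rV[int]_n * int)) p q :=
  forall l l', l \in L -> l' \in L ->
    (feval l p <= feval l' p) = (feval l q <= feval l' q).

Lemma near_seq_all (T : eqType) (s : seq T) (P : T -> 'rV[R]_n -> Prop) p :
  (forall i, i \in s -> \forall q \near p, P i q) ->
  \forall q \near p, forall i, i \in s -> P i q.
Proof.
elim: s => [_|i s IH H]; first by near=> q.
have Hi := H i (mem_head _ _).
have Hs : \forall q \near p, forall i, i \in s -> P i q.
  by apply: IH => j js; apply: H; rewrite inE js orbT.
near=> q => j; rewrite inE => /orP[/eqP ->|].
  by near: q.
by move: j; near: q.
Unshelve. all: by end_near. Qed.

(** Independence kills the linear part of [l - l']; the integer constant that is left must then
    vanish too. *)
Lemma int_independent_eq p l l' :
  int_independent p -> feval l p = feval l' p -> l = l'.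
Proof.
move=> ip ll'.
have E : feval (l - l') p = 0.
  by apply: (addIr (feval l' p)); rewrite -fevalD subrK add0r.
have E1 : (l - l').1 = 0.
  by apply/eqP; apply: contraT => /ip; rewrite E eqxx.
have E2 : (l - l').2 = 0.
  move: E; rewrite (surjective_pairing (l - l')) E1 feval_const => /eqP.
  by rewrite intr_eq0 => /eqP.
by apply/eqP; rewrite -subr_eq0 (surjective_pairing (l - l')) E1 E2.
Qed.

(** Finitely many strict inequalities persist near [p] by continuity, and ties at [p] come only from
    identical forms. *)
Lemma near_same_order L p :
  int_independent p -> \forall q \near p, same_order L p q.
Proof.
move=> ip.
suff: \forall q \near p, forall l, l \in L -> forall l', l' \in L ->
    feval l p < feval l' p -> feval l q < feval l' q.
  apply: filterS => q H l l' Ll Ll'.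
  case: (ltgtP (feval l p) (feval l' p)) => [/H|/H|].
  - by move=> /(_ Ll Ll') /ltW ->.
  - by move=> /(_ Ll' Ll); rewrite ltNge => /negbTE ->.
  - by move=> /(int_independent_eq ip) ->; rewrite lexx.
apply: near_seq_all => l Ll; apply: near_seq_all => l' Ll'.
have [ll'|?] := boolP (feval l p < feval l' p); last by near=> q.
have := @feval_continuous l p; have := @feval_continuous l' p.
pose m := (feval l p + feval l' p) / 2.
have m1 : feval l p < m by rewrite /m; lra.
have m2 : m < feval l' p by rewrite /m; lra.
move=> /(_ _ (lt_nbhsr m2)) c2 /(_ _ (lt_nbhsl m1)) c1.
near=> q => _; apply: (@lt_trans _ _ m); near: q; [exact: c1|exact: c2].
Unshelve. all: by end_near. Qed.

(** Comparisons by [<=] alone locate [x], because the intervals considered are closed on the left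
    and open on the right. *)
Definition same_position (L : seq ('rV[int]_n * int)) q (x : R) q' (x' : R) :=
  forall l, l \in L -> (feval l q <= x) = (feval l q' <= x').

(* [S q] is a union of intervals [a, b) with endpoints among the values of
   the forms of [L] at [q], the same ones for all [q]. *)
Definition described_by L (S : 'rV[R]_n -> set R) :=
  forall q x q' x', same_position L q x q' x' -> S q x -> S q' x'.

Lemma same_position_sym L q x q' x' :
  same_position L q x q' x' -> same_position L q' x' q x.
Proof. by move=> H l lL; rewrite H. Qed.

Lemma sub_same_position L L' q x q' x' : {subset L <= L'} ->
  same_position L' q x q' x' -> same_position L q x q' x'.
Proof. by move=> LL' H l /LL'; exact: H. Qed.

Lemma inc_homeo_position L q q' h k : inc_homeo h k ->
  (forall l, l \in L -> h (feval l q) = feval l q') ->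
  forall x, same_position L q x q' (h x).
Proof. by case=> _ _ hm hL x l lL; rewrite -(hL _ lL) hm. Qed.

End IntegerForms.

(** * Images of an interval translation map, and stability *)

Section OrbitImages.
Variables (R : realType) (r : nat).
Local Notation form := ('rV[int]_(r + r.-1) * int)%type.
Implicit Types (p q : 'rV[R]_(r + r.-1)) (L : seq form).

Definition gam_form (i : 'I_r) : form := (delta_mx ord0 (lshift r.-1 i), 0).

Definition bet_form (k : nat) : form :=
  if k is k'.+1 then
    if insub k' is Some j then (delta_mx ord0 (rshift r (j : 'I_r.-1)), 0)
    else (0, 1)
  else (0, 0).

Lemma feval_gam i q : feval (gam_form i) q = gam q i.
Proof. exact: feval_coord. Qed.

Lemma feval_bet k q : feval (bet_form k) q = bet q k.
Proof.
case: k => [|k] /=; first exact: feval_const.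
by case: insub => [j|]; [exact: feval_coord|exact: feval_const].
Qed.

Definition bet_forms := [seq bet_form k | k <- iota 0 r.+1].

Lemma bet_formP k : (k <= r)%N -> bet_form k \in bet_forms.
Proof. by move=> kr; apply: map_f; rewrite mem_iota ltnS. Qed.

(** A set is cut at the discontinuities and its pieces are translated, so the endpoints are shifted
    by every [gam_form i]. The unshifted ones are kept for points outside [[0, 1)], which [itm]
    fixes. *)
Definition image_forms L :=
  (bet_forms ++ L) ++
  [seq l + gam_form i | l <- bet_forms ++ L, i <- enum 'I_r].

(** If [y] is a preimage of [x] on branch [i], then [x' - gam q' i] has at [q'] the position of [y]
    at [q], so it lies on the same branch and in [S q']. *)
Lemma itm_described_image L S : described_by L S ->
  described_by (image_forms L) (fun q => itm q @` S q).
Proof.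
move=> LS q x q' x' H [y Sy]; rewrite /itm.
pose M := bet_forms ++ L.
have transfer z z' : same_position M q z q' z' ->
    (fun i : 'I_r => bet q i <= z < bet q i.+1) =1
    (fun i : 'I_r => bet q' i <= z' < bet q' i.+1).
  have bM k : (k <= r)%N -> bet_form k \in M.
    by move=> /bet_formP; rewrite mem_cat => ->.
  move=> P i; have := P _ (bM _ (ltnW (ltn_ord i))).
  have := P _ (bM _ (ltn_ord i)).
  by rewrite !feval_bet !ltNge => -> ->.
have LM : {subset L <= M} by move=> l; rewrite mem_cat orbC => ->.
case E : [pick _ | _] => [i|] yx.
  have P : same_position M q y q' (x' - gam q' i).
    move=> l lM; have lF : l + gam_form i \in image_forms L.
      rewrite mem_cat; apply/orP; right; apply/allpairsP.
      by exists (l, i); rewrite mem_enum.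
    by have := H _ lF; rewrite !fevalD !feval_gam -yx lerD2r lerBrDr.
  exists (x' - gam q' i); first exact: (LS _ _ _ _ (sub_same_position LM P) Sy).
  by rewrite -(eq_pick (transfer _ _ P)) E subrK.
have P : same_position M q y q' x'.
  by rewrite yx; apply: sub_same_position H => l; rewrite !mem_cat => ->.
exists x'; first exact: (LS _ _ _ _ (sub_same_position LM P) Sy).
by rewrite -(eq_pick (transfer _ _ P)) E.
Qed.

Fixpoint Xn_forms N : seq form :=
  if N is N'.+1 then image_forms (Xn_forms N') else [:: (0, 0); (0, 1)].

Lemma Xn0 q : Xn q 0 = unitI R.
Proof. by rewrite /Xn /= image_id. Qed.

Lemma XnS q N : Xn q N.+1 = itm q @` Xn q N.
Proof.
rewrite /Xn; apply/seteqP; split=> [_ [y Iy <-]|_ [_ [y Iy <-] <-]].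
  by exists (iter N (itm q) y) => //; exists y.
by exists y.
Qed.

Lemma Xn_described N : described_by (Xn_forms N) (fun q => Xn q N).
Proof.
elim: N => [|N IH] q x q' x'.
  move=> H; rewrite !Xn0 /unitI /=.
  have := H (0, 0) (mem_head _ _); have := H (0, 1) (mem_last _ [:: _]).
  by rewrite !feval_const => E1 E0; rewrite -E0 !ltNge E1.
by rewrite !XnS => H; exact: (itm_described_image IH H).
Qed.

Lemma itm_unitI q x : ITM q -> unitI R x -> unitI R (itm q x).
Proof.
move=> qI Ix; rewrite /itm; case: pickP => // i /andP[bx xb].
by have [_ g0 g1] := qI i; rewrite /unitI /=; lra.
Qed.

Lemma Xn_decreasing q N : ITM q -> Xn q N.+1 `<=` Xn q N.
Proof.
move=> qI; elim: N => [|N IH].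
  by rewrite XnS Xn0 => _ [x Ix <-]; exact: itm_unitI.
by rewrite (XnS _ N.+1) {2}XnS; exact: image_subset.
Qed.

Lemma attr_stationary q N : ITM q -> Xn q N.+1 = Xn q N -> attr q = Xn q N.
Proof.
move=> qI XN; have up k : Xn q (N + k) = Xn q N.
  by elim: k => [|k IH]; rewrite ?addn0// addnS XnS IH -XnS.
apply/seteqP; split=> [x|x Xx n _]; first exact.
have [nN|/ltnW Nn] := leqP n N; last by rewrite -(subnKC Nn) up.
have down k : Xn q (n + k) `<=` Xn q n.
  elim: k => [|k IH]; rewrite ?addn0// addnS.
  by move=> y Xy; apply: IH; exact: Xn_decreasing Xy.
by apply: (down (N - n)%N); rewrite subnKC.
Qed.

(** The attractors at [q] and [q'] are both the [N]-th image, which the forms describe; a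
    homeomorphism matching the values of the forms therefore carries one to the other. *)
Lemma attr_transport L N p q q' d :
  Xn p N.+1 = Xn p N -> ITM q -> ITM q' -> 0 <= d ->
  {subset Xn_forms N.+1 ++ Xn_forms N <= L} ->
  same_order L p q -> same_order L p q' ->
  (forall l, l \in L -> `|feval l q - feval l q'| <= d) ->
  exists h k, [/\ inc_homeo h k,
    forall l, l \in L -> h (feval l q) = feval l q',
    forall x, attr q x <-> attr q' (h x) &
    forall x, `|h x - x| <= (2 ^+ size L - 1) * d].
Proof.
move=> XN qI q'I d0 NL pq pq' Ld.
(* Stabilisation at step [N] is inherited from [p]: one homeomorphism maps both [Xn p N.+1] and
   [Xn p N] onto their counterparts at [s]. *)
have stat s : ITM s -> same_order L p s -> attr s = Xn s N.
  move=> sI ps; apply: attr_stationary => //.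
  have [|||h [k [hk hL _]]] := @exists_inc_homeo R _ L
    (fun l => feval l p) (fun l => feval l s)
    (\sum_(l <- L) `|feval l p - feval l s|).
  - exact: sumr_ge0.
  - exact: ps.
  - by move=> l lL; rewrite (big_rem l)//= lerDl sumr_ge0.
  have pos x : same_position L p x s (h x) := inc_homeo_position hk hL x.
  have D M x : {subset Xn_forms M <= L} -> Xn p M x <-> Xn s M (h x).
    move=> ML; have P := sub_same_position ML (pos x).
    by split; apply: (@Xn_described M); [|exact: same_position_sym].
  have kh x : h (k x) = x by case: hk.
  apply/seteqP; split=> x; rewrite -(kh x) -!D ?XN// => l lN; apply: NL;
    by rewrite mem_cat lN ?orbT.
have [|h [k [hk hL hd]]] := @exists_inc_homeo R _ L
  (fun l => feval l q) (fun l => feval l q') d d0 _ Ld.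
  by move=> l l' lL l'L; rewrite -pq// -pq'.
exists h, k; split=> // x; rewrite !stat//.
have P : same_position (Xn_forms N) q x q' (h x).
  apply: (sub_same_position _ (inc_homeo_position hk hL x)) => l lN.
  by apply: NL; rewrite mem_cat lN orbT.
by split; apply: (@Xn_described N); [|exact: same_position_sym].
Qed.

Lemma hausdorff_dist_le (A B : set R) d e : 0 <= d < e ->
  (forall x, A x -> exists2 y, B y & `|x - y| <= d) ->
  (forall y, B y -> exists2 x, A x & `|x - y| <= d) ->
  (hausdorff_dist A B < e%:E)%E.
Proof.
(* Thickenings use open balls and the infimum must stay below [e], so the radius is taken strictly
   between [d] and [e]. *)
move=> /andP[d0 de] AB BA; pose m := (d + e) / 2.
have dm : d < m by rewrite /m; lra.
apply: (@le_lt_trans _ _ m%:E); last by rewrite lte_fin /m; lra.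
apply: ereal_inf_lbound; exists m => //; split; first lra.
- move=> x /AB[y By xy]; exists y => //.
  by rewrite /ball /= distrC; exact: le_lt_trans dm.
- by move=> y /BA[x Ax xy]; exists x => //; exact: le_lt_trans dm.
Qed.

(** One homeomorphism serves all the conditions: it moves points little, maps one closed attractor
    onto the other, and matches the discontinuities. *)
Lemma int_independent_stable p :
  ITM p -> finite_type p -> int_independent p -> stable p.
Proof.
move=> pI [N XN] ip; split=> //.
(* The added forms make the homeomorphism match the discontinuities and fix the ends 0 and 1 of the
   interval. *)
pose L := (bet_forms ++ [:: (0, 0); (0, 1)]) ++ Xn_forms N.+1 ++ Xn_forms N.
have NL : {subset Xn_forms N.+1 ++ Xn_forms N <= L}.
  by move=> l; rewrite [in X in _ -> X]mem_cat orbC => ->.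
exists [set q | same_order L p q]; first exact: near_same_order.
have T q q' d := @attr_transport L N p q q' d XN.
(* Outside the continuity condition any bound on the distances will do; their sum is one. *)
have crude q q' : exists2 d, 0 <= d &
    forall l, l \in L -> `|feval l q - feval l q'| <= d :> R.
  exists (\sum_(l <- L) `|feval l q - feval l q'|); first exact: sumr_ge0.
  by move=> l lL; rewrite (big_rem l)//= lerDl sumr_ge0.
split=> [q [/= pq qI] e e0|q [/= pq qI]|q [/= pq qI]].
(* The homeomorphism amplifies [d] by less than [2 ^+ size L], so its displacement is at most
   [e / 2]. *)
- pose d := e / 2 ^+ (size L).+1.
  have d0 : 0 < d by rewrite divr_gt0 ?exprn_gt0.
  have : \forall q' \near q, forall l, l \in L -> `|feval l q - feval l q'| <= d.
    apply: near_seq_all => l _.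
    have /cvgrPdist_le/(_ _ d0) := @feval_continuous R _ l q; exact.
  apply: filterS => q' Ld [/= pq' q'I].
  have [h [k [hk _ hattr hd]]] := T q q' d qI q'I (ltW d0) NL pq pq' Ld.
  have hcl := homeo_preserves_closure hk hattr.
  have hd' x : `|h x - x| <= e / 2.
    apply: le_trans (hd x) _.
    have -> : e / 2 = 2 ^+ size L * d.
      have m0 : 2 ^+ size L != 0 :> R by rewrite expf_neq0.
      by rewrite /d exprS; move: (2 ^+ size L) m0 => m m0; field.
    by rewrite ler_wpM2r ?(ltW d0)// gerBl.
  have kh x : h (k x) = x by case: hk.
  apply: (@hausdorff_dist_le _ _ (e / 2)); first lra.
  + move=> x cx; exists (k x); last by rewrite -[in X in X - _](kh x).
    by apply/hcl; rewrite kh.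
  + by move=> y cy; exists (h y) => //; exact/hcl.
- have [d d0 Ld] := crude q p.
  have [h [k [hk _ hattr _]]] := T q p d qI pI d0 NL pq (fun _ _ _ _ => erefl) Ld.
  have hcl := homeo_preserves_closure hk hattr.
  have [kh' kh _] := hk.
  exists h, k; split.
  + by apply: continuous_subspaceT; exact: inc_homeo_continuous hk.
  + by apply: continuous_subspaceT; exact: inc_homeo_continuous (inc_homeo_sym hk).
  + by move=> x /hcl.
  + by move=> x cx; apply/hcl; rewrite kh.
  + by split=> x _.
- have [d d0 Ld] := crude q p.
  have [h [k [hk hL hattr _]]] := T q p d qI pI d0 NL pq (fun _ _ _ _ => erefl) Ld.
  have hcl := homeo_preserves_closure hk hattr.
  have [_ _ hm] := hk; have hlt := leW_mono hm.
  have hb j : (j <= r)%N -> h (bet q j) = bet p j.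
    by move=> jr; rewrite -!feval_bet hL// !mem_cat bet_formP.
  have h0 : h 0 = 0.
    by have := hL (0, 0); rewrite !mem_cat inE eqxx orbT !feval_const; exact.
  have h1 : h 1 = 1.
    by have := hL (0, 1); rewrite !mem_cat !inE eqxx !orbT !feval_const; exact.
  apply: eq_card => j; rewrite !inE; apply/asboolP/asboolP.
  all: rewrite -hb; last by rewrite (leq_trans (ltn_ord j)) ?leq_pred.
  (* With 0 and 1 written as [h 0] and [h 1], membership in the interval transfers by monotonicity
     of [h]. *)
  all: rewrite /unitI /= -[in X in X <= h _]h0 -[in X in h _ < X]h1 hm hlt.
  all: by move=> [? nc]; split=> // /hcl.
Qed.

End OrbitImages.

(** * Covers by boxes and rational hyperplanes *)

Section NullSets.
Variables (R : realType) (n : nat).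
Implicit Types (A : set 'rV[R]_n) (B : 'rV[R]_n * 'rV[R]_n) (e : R).

Definition volume B : R := \prod_(i < n) (B.2 ord0 i - B.1 ord0 i).

Definition proper_box B := forall i, B.1 ord0 i <= B.2 ord0 i.

Lemma volume_ge0 B : proper_box B -> 0 <= volume B.
Proof. by move=> B0; apply: prodr_ge0 => i _; rewrite subr_ge0. Qed.

Definition box_cover A e := exists B : nat -> 'rV[R]_n * 'rV[R]_n,
  [/\ forall k, proper_box (B k), A `<=` \bigcup_k box (B k).1 (B k).2 &
      (\sum_(0 <= k <oo) (volume (B k))%:E <= e%:E)%E].

Lemma lebesgue_outer_eq0 A :
  (forall e, 0 < e -> box_cover A e) -> lebesgue_outer A = 0%E.
Proof.
move=> cA; apply/le_anti/andP; split; last first.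
  apply: le_ereal_inf_tmp => _ [a [b [ab _ ->]]].
  by apply: nneseries_ge0 => k _ _; rewrite lee_fin; exact: (@volume_ge0 (a k, b k) (ab k)).
apply/lee_addgt0Pr => e /cA[B [B0 AB Be]]; rewrite add0e.
apply: le_trans Be; apply: ereal_inf_lbound.
by exists (fun k => (B k).1), (fun k => (B k).2).
Qed.

(** The covers are interleaved along a bijection [f] from [nat] to [nat * nat]; terms being
    nonnegative, the volumes may be summed row by row, with geometric budgets adding up to [e]. *)
Lemma box_cover_bigcup (A : nat -> set 'rV[R]_n) e : 0 <= e ->
  (forall m, box_cover (A m) (e / (2 ^ m.+1)%:R)) ->
  box_cover (\bigcup_m A m) e.
Proof.
move=> e0 /choice[B PB].
have /card_esym/ppcard_eqP[f] := card_nat2.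
have v0 (m k : nat) : (0 <= (volume (B m k))%:E)%E.
  by have [B0 _ _] := PB m; rewrite lee_fin volume_ge0.
exists (fun k => B (f k).1 (f k).2); split.
- by move=> k; have [B0 _ _] := PB (f k).1.
- move=> x [m _]; have [_ AB _] := PB m => /AB[k _ xk].
  by exists (f^-1%FUN (m, k)) => //; rewrite invK ?inE.
rewrite nneseries_esumT//.
rewrite -(@reindex_esum _ _ _ setT setT f (fun k => (volume (B k.1 k.2))%:E)); last first.
  exact: 'bij_f.
have -> : [set: nat * nat] = [set: nat] `*`` (fun=> [set: nat]).
  by apply/seteqP; split.
rewrite -(esum_esum (a := fun m k => (volume (B m k))%:E))//.
rewrite -nneseries_esumT; last by move=> m; apply: esum_ge0.
apply: le_trans (epsilon_trick0 xpredT e0).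
apply: lee_nneseries => [m _ _|m _]; first exact: esum_ge0.
by rewrite -nneseries_esumT//; have [] := PB m.
Qed.

Lemma box_cover_finite (s : seq ('rV[R]_n * 'rV[R]_n)) A : (0 < n)%N ->
  (forall B, B \in s -> proper_box B) ->
  (forall x, A x -> exists2 B, B \in s & box B.1 B.2 x) ->
  box_cover A (\sum_(B <- s) volume B).
Proof.
move=> n0 s0 As; pose B k := nth (0, 0) s k.
have B0 k : proper_box (B k).
  have [ks|sk] := ltnP k (size s); first exact/s0/mem_nth.
  by rewrite /B nth_default.
have v0 k : (0 <= (volume (B k))%:E)%E by rewrite lee_fin volume_ge0.
exists B; split=> //.
  move=> x /As[b bs xb]; exists (index b s) => //.
  by rewrite /B nth_index.
rewrite (@nneseries_split _ _ 0 (size s))// add0n eseries0 ?adde0; last first.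
  (* The padding boxes are points. Their volume is 0 because the dimension is positive; an empty
     product would be 1. *)
  move=> k sk _; rewrite /B nth_default// /volume (bigD1 (Ordinal n0))//=.
  by rewrite subrr mul0r.
by rewrite sumEFin (big_nth (0, 0)).
Qed.

Lemma box_cover_le A e e' : e <= e' -> box_cover A e -> box_cover A e'.
Proof.
move=> ee' [B [B0 AB Be]]; exists B; split=> //.
by apply: le_trans Be _; rewrite lee_fin.
Qed.

Lemma sub_box_cover A A' e : A `<=` A' -> box_cover A' e -> box_cover A e.
Proof. by move=> AA' [B [B0 AB Be]]; exists B; split=> // x /AA' /AB. Qed.

Lemma grid_cell (N : nat) (s x : R) : 0 <= s -> 0 <= x <= N.+1%:R * s ->
  exists k : 'I_N.+1, k%:R * s <= x <= k.+1%:R * s.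
Proof.
move=> s0; elim: N => [|N IH] /andP[x0 xN].
  by exists ord0; rewrite mul0r x0 xN.
have [xN'|/ltW Nx] := leP x (N.+1%:R * s).
  have [|k kx] := IH; first by rewrite x0.
  by exists (widen_ord (leqnSn _) k).
by exists ord_max; rewrite Nx xN.
Qed.

(* On a cell of a grid of mesh [s] in the coordinates other than [j], the
   [j]-th coordinate of a point of the hyperplane varies by at most [K * s].
   The grid also has a [j]-th index, all of whose values but [0] carry
   degenerate boxes, so that the total volume is a product of sums. *)
Lemma hyperplane_box_cover (l : 'rV[int]_n * int) (j : 'I_n) (M : nat) e :
  l.1 ord0 j != 0 -> 0 < e ->
  box_cover [set q : 'rV[R]_n | feval l q = 0 /\
    forall i, `|q ord0 i| <= M%:R] e.
Proof.
move=> lj e0; pose c i : R := (l.1 ord0 i)%:~R.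
have cj : c j != 0 by rewrite intr_eq0.
pose K : R := \sum_(i | i != j) `|c i| / `|c j|.
have K0 : 0 <= K by apply: sumr_ge0 => i _; rewrite divr_ge0.
(* The total volume will be [C / N.+1]: a factor [2 * M%:R] for each coordinate other than [j],
   times [2 * (K * s)]. *)
pose C : R := \prod_(i < n | i != j) (2 * M%:R) * (2 * K * (2 * M%:R)).
have C0 : 0 <= C by rewrite /C mulr_ge0 ?prodr_ge0 ?mulr_ge0// => *; rewrite mulr_ge0.
pose N := Num.bound (C / e).
have CN : C / N.+1%:R <= e.
  rewrite ler_pdivrMr ?ltr0n// mulrC -ler_pdivrMr//.
  apply: ltW; apply: lt_le_trans (archi_boundP _) _; first by rewrite divr_ge0// ltW.
  by rewrite ler_nat.
pose s : R := 2 * M%:R / N.+1%:R.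
have s0 : 0 <= s by rewrite divr_ge0 ?mulr_ge0.
have sN : N.+1%:R * s = 2 * M%:R by rewrite /s mulrC divfK ?pnatr_eq0.
(* [y g] is the lower corner of the cell [g], and [z g] the [j]-th coordinate that puts this corner
   on the hyperplane. *)
pose y (g : {ffun 'I_n -> 'I_N.+1}) i : R := - M%:R + (g i)%:R * s.
pose z g : R := - (l.2%:~R + \sum_(i | i != j) c i * y g i) / c j.
pose w (k : 'I_N.+1) : R := if k == ord0 then K * s else 0.
have w0 k : 0 <= w k by rewrite /w; case: ifP => // _; rewrite mulr_ge0.
pose B g : 'rV[R]_n * 'rV[R]_n :=
  (\row_i if i == j then z g - w (g j) else y g i,
   \row_i if i == j then z g + w (g j) else y g i + s).
pose F i k : R := if i == j then 2 * w k else s.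
have volB g : volume (B g) = \prod_i F i (g i).
  apply: eq_bigr => i _; rewrite !mxE /F; case: eqP => [->|_]; ring.
apply: (@box_cover_le _ (\sum_(b <- [seq B g | g <- enum {ffun 'I_n -> 'I_N.+1}]) volume b)).
  rewrite big_map big_enum /= (eq_bigr _ (fun g _ => volB g)).
  (* The sum over all index functions of a product becomes a product of sums, one for each
     coordinate. *)
  rewrite -(bigA_distr_bigA F) (bigD1 j)//=.
  have -> : \sum_k F j k = 2 * (K * s).
    rewrite /F eqxx (bigD1 ord0)//= /w eqxx big1 ?addr0// => k /negbTE ->.
    by rewrite mulr0.
  rewrite (eq_bigr (fun=> 2 * M%:R)) => [|i /negbTE ij]; last first.
    by rewrite /F ij sumr_const card_ord -[s *+ _]mulr_natl sN.
  apply: le_trans CN; rewrite le_eqVlt; apply/orP; left; apply/eqP.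
  by rewrite /C /s; move: (\prod_(_ | _) _) => P; field; rewrite ?pnatr_eq0.
apply: box_cover_finite.
- exact: leq_ltn_trans (ltn_ord j).
- move=> _ /mapP[g _ ->] i; rewrite !mxE; have := w0 (g j).
  by case: eqP => _; lra.
move=> q [lq qM].
have cell i : exists k : 'I_N.+1, k%:R * s <= q ord0 i + M%:R <= k.+1%:R * s.
  apply: grid_cell => //; rewrite sN.
  by have := qM i; rewrite ler_norml => /andP[? ?]; lra.
have [g0 g0P] := choice cell.
(* The [j]-th index must be 0, the one whose boxes have half-width [K * s]. *)
pose g := [ffun i => if i == j then ord0 else g0 i].
exists (B g); first by apply: map_f; rewrite mem_enum.
have yq i : i != j -> 0 <= q ord0 i - y g i <= s.
  move=> /negbTE ij; rewrite /y ffunE ij; have := g0P i.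
  by rewrite -natr1 mulrDl mul1r; lra.
have qj : q ord0 j = - (l.2%:~R + \sum_(i | i != j) c i * q ord0 i) / c j.
  apply: (mulIf cj); rewrite divfK//; move: lq; rewrite /feval (bigD1 j)//= -/(c j).
  by move=> /eqP; rewrite -addrA addr_eq0 => /eqP; rewrite mulrC [in RHS]addrC.
have qz : `|q ord0 j - z g| <= K * s.
  have -> : q ord0 j - z g = \sum_(i | i != j) c i * (y g i - q ord0 i) / c j.
    rewrite qj /z -mulr_suml -mulrBl; congr (_ / _).
    under [RHS]eq_bigr do rewrite mulrBr.
    by rewrite sumrB; ring.
  rewrite /K mulr_suml; apply: le_trans (ler_norm_sum _ _ _) _.
  apply: ler_sum => i ij; rewrite !normrM normfV mulrAC ler_wpM2l ?divr_ge0//.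
  by rewrite distrC; have /andP[? ?] := yq i ij; rewrite ger0_norm.
move=> i; rewrite !mxE /w ffunE !eqxx; case: eqP => [->|/eqP ij].
  by rewrite -ler_distlC distrC.
by have := yq i ij; lra.
Qed.

End NullSets.

(** Each hyperplane is exhausted by its parts in the cubes of radius [M], and [unpickle] enumerates
    the pairs [(l, M)]. *)
Lemma int_dependent_box_cover (R : realType) (n : nat) (e : R) :
  (0 < n)%N -> 0 < e -> box_cover [set p : 'rV[R]_n | ~ int_independent p] e.
Proof.
move=> n0 e0.
pose A m : set 'rV[R]_n :=
  if unpickle m is Some (l, M) then
    [set q | l.1 != 0 /\ feval l q = 0 /\ forall i, `|q ord0 i| <= (M : nat)%:R]
  else set0.
have empty_cover d : 0 <= d -> box_cover (set0 : set 'rV[R]_n) d.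
  move=> d0; apply: box_cover_le (@box_cover_finite R n [::] set0 n0 _ _) => //.
  by rewrite big_nil.
apply: (@sub_box_cover _ _ _ (\bigcup_m A m)); last first.
  apply: box_cover_bigcup (ltW e0) _ => m.
  have d0 : 0 < e / (2 ^ m.+1)%:R by rewrite divr_gt0// ltr0n expn_gt0.
  (* Codes of no pair, and forms with zero linear part, contribute the empty set. *)
  rewrite /A; case: unpickle => [[l M]|]; last exact/empty_cover/ltW.
  have [l0|[j lj]] : l.1 = 0 \/ exists j, l.1 ord0 j != 0.
  - have [/forallP l0|] := boolP [forall j, l.1 ord0 j == 0].
      by left; apply/rowP => j; rewrite mxE; apply/eqP.
    by rewrite negb_forall => /existsP; right.
  - apply: sub_box_cover (empty_cover _ (ltW d0)) => q [].
    by rewrite l0 eqxx.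
  - by apply: sub_box_cover (hyperplane_box_cover M lj d0) => q [_].
move=> p /= /existsNP[l /not_implyP[l0 /negP/negPn/eqP lp]].
pose S := \sum_i `|p ord0 i|.
exists (pickle (l, Num.bound S)) => //; rewrite /A pickleK /=.
split=> //; split=> // i; apply: le_trans (ltW (archi_boundP _)).
  by rewrite /S (bigD1 i)//= lerDl sumr_ge0.
exact: sumr_ge0.
Qed.

Theorem theoremA7 (R : realType) (r : nat) (hr : (2 <= r)%N) :
  lebesgue_outer
    [set p | [/\ @ITM R r p, finite_type p & ~ stable p]] = 0%E.
Proof.
apply: lebesgue_outer_eq0 => e e0.
apply: sub_box_cover (int_dependent_box_cover _ e0).
  by move=> p [pI pF nS] ip; apply: nS; exact: int_independent_stable.
by rewrite addn_gt0 (ltnW hr).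
Qed.
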